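(* Let $F$ be a finitely generated group containing an isometrically embedded copy of $\mathbb{Z}\cong\langle t\rangle$ with respect to a finite generating set $Y$ of $F$ (i.e. $t\in F$ satisfies $|t^m|_Y=|m|$ for all $m\in\mathbb{Z}$, where $|\cdot|_Y$ is word length with respect to $Y$), and let $G$ be any finitely generated non-trivial group with finite generating set $X$. Then $G\wr F$ contains seesaw words of arbitrary swing with respect to at least one generating set; that is, there is a finite generating set $S$ of $G\wr F$ such that for every positive integer $k$ there is an element of $G\wr F$ which is a seesaw word of swing $k$ with respect to some generator in $S$.
   Context: The wreath product $G\wr F$ is the semidirect product $\left(\bigoplus_{f\in F}G\right)\rtimes F$, where $F$ acts by translating the indices; $G$ is identified with the copy of $G$ indexed by the identity of $F$. Let $H$ be a group with finite generating set $S$ and let $|\cdot|$ be word length with respect to $S$. An element $w\in H$ is a seesaw word of swing $k$ with respect to a generator $g\in S$ (in the generating set $S$) if the following hold. (1) $g$ is the unique element of $S$ with $|wg^{\pm1}|=|w|-1$ (for both signs), and for all other $h\in S$ we have $|wh^{\pm1}|\ge|w|$ (for both signs). (2) For all integers $l\in[1,k-1]$ we have $|wg^{l}|=|wg^{l-1}|-1$, and $|wg^{l-1}h^{\pm1}|\ge|wg^{l-1}|$ for all $h\in S$ with $h\ne g$; and the analogous condition holds with $g$ replaced by $g^{-1}$, i.e. for all integers $l\in[1,k-1]$, $|wg^{-l}|=|wg^{-(l-1)}|-1$ and $|wg^{-(l-1)}h^{\pm1}|\ge|wg^{-(l-1)}|$ for all $h\in S$ with $h\ne g$. *)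

(* Defs.v *)
From HB Require Import structures.
From mathcomp Require Import all_boot.
From mathcomp Require Import ssralg ssrint finmap boolp.

Set Implicit Arguments.
Unset Strict Implicit.
Unset Printing Implicit Defensive.

Local Open Scope group_scope.
Local Open Scope fset_scope.

(* ssrint only provides integer powers in rings. *)
Definition expgz (H : groupType) (x : H) (m : int) : H :=
  match m with
  | Posz n => x ^+ n
  | Negz n => x ^- n.+1
  end.

Section WordLength.
Variables (H : groupType) (S : {fset H}).

Definition is_word (s : seq H) : Prop :=
  forall x, x \in s -> x \in S \/ x^-1 \in S.

Definition generates : Prop :=
  forall h : H, exists2 s : seq H, is_word s & \prod_(x <- s) x = h.

Definition has_word (h : H) : pred nat := fun n =>
  `[< exists s : seq H,
        [/\ is_word s, size s = n & \prod_(x <- s) x = h] >].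

(* Outside the subgroup generated by [S] the value is 0; it is only meaningful
   when [generates] holds. *)
Definition word_length (h : H) : nat :=
  if pselect (exists n, has_word h n) is left Hh then ex_minn Hh else 0%N.

Definition isometric_Z (t : H) : Prop :=
  forall m : int, word_length (expgz t m) = absz m.

Local Notation len := word_length.

(* |x| = |y| - 1 is written |x| + 1 = |y|, subtraction on nat being truncated.
   The exponents l and l - 1 are never negative, so l : nat loses nothing. *)
Definition seesaw_word (k : nat) (g w : H) : Prop :=
  [/\ g \in S,
      [/\ (len (w * g)).+1 = len w,
          (len (w * g^-1)).+1 = len w,
          forall h, h \in S ->
            (len (w * h)).+1 = len w -> (len (w * h^-1)).+1 = len w -> h = g
        & forall h, h \in S -> h <> g ->
            (len w <= len (w * h))%N /\ (len w <= len (w * h^-1))%N]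
    & forall l : nat, (1 <= l <= k - 1)%N ->
      [/\ (len (w * g ^+ l)).+1 = len (w * g ^+ (l - 1)),
          forall h, h \in S -> h <> g ->
            (len (w * g ^+ (l - 1)) <= len (w * g ^+ (l - 1) * h))%N /\
            (len (w * g ^+ (l - 1)) <= len (w * g ^+ (l - 1) * h^-1))%N,
          (len (w * g ^- l)).+1 = len (w * g ^- (l - 1))
        & forall h, h \in S -> h <> g ->
            (len (w * g ^- (l - 1)) <= len (w * g ^- (l - 1) * h))%N /\
            (len (w * g ^- (l - 1)) <= len (w * g ^- (l - 1) * h^-1))%N]].

End WordLength.

Section DirectSum.
Variables (F : choiceType) (G : groupType).

Definition dsum : Type := {fsfun F -> G with 1}.

HB.instance Definition _ := Choice.on dsum.

Definition dsum_fun (a : dsum) : F -> G := fun_of_fsfun a.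
Coercion dsum_fun : dsum >-> Funclass.

Definition dsum_one : dsum := [fsfun].
Definition dsum_mul (a b : dsum) : dsum :=
  [fsfun x in finsupp a `|` finsupp b => a x * b x | 1].
Definition dsum_inv (a : dsum) : dsum :=
  [fsfun x in finsupp a => (a x)^-1 | 1].

Lemma dsumP (a b : dsum) : (forall x, a x = b x) <-> a = b.
Proof. exact: fsfunP. Qed.

Lemma dsum_oneE x : dsum_one x = 1.
Proof. by rewrite /dsum_fun fsfunE. Qed.

Lemma dsum_mulE a b x : dsum_mul a b x = a x * b x.
Proof.
rewrite /dsum_mul /dsum_fun fsfunE inE; case: finsuppP => //= _.
by case: finsuppP => //= _; rewrite mul1g.
Qed.

Lemma dsum_invE a x : dsum_inv a x = (a x)^-1.
Proof. by rewrite /dsum_inv /dsum_fun fsfunE; case: finsuppP => //= _; rewrite invg1. Qed.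

Lemma dsum_mulA : associative dsum_mul.
Proof. by move=> a b c; apply/dsumP => x; rewrite !dsum_mulE mulgA. Qed.
Lemma dsum_mul1g : left_id dsum_one dsum_mul.
Proof. by move=> a; apply/dsumP => x; rewrite dsum_mulE dsum_oneE mul1g. Qed.
Lemma dsum_mulg1 : right_id dsum_one dsum_mul.
Proof. by move=> a; apply/dsumP => x; rewrite dsum_mulE dsum_oneE mulg1. Qed.
Lemma dsum_mulVg : left_inverse dsum_one dsum_inv dsum_mul.
Proof.
by move=> a; apply/dsumP => x; rewrite dsum_mulE dsum_invE dsum_oneE mulVg.
Qed.
Lemma dsum_mulgV : right_inverse dsum_one dsum_inv dsum_mul.
Proof.
by move=> a; apply/dsumP => x; rewrite dsum_mulE dsum_invE dsum_oneE mulgV.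
Qed.

HB.instance Definition _ :=
  isGroup.Build dsum dsum_mulA dsum_mul1g dsum_mulg1 dsum_mulVg dsum_mulgV.

End DirectSum.

Section Wreath.
Variables (G F : groupType).

(* Left translation moves the copy of G at index y to the copy at f * y. *)
Definition translate (f : F) (a : dsum F G) : dsum F G :=
  [fsfun x in [fset f * y | y in finsupp a] => a (f^-1 * x) | 1].

Lemma translateE f a x : translate f a x = a (f^-1 * x).
Proof.
rewrite /translate /dsum_fun fsfunE; case: ifPn => //; apply: contraNeq => ax.
apply/imfsetP; exists (f^-1 * x); last by rewrite mulgA mulgV mul1g.
by rewrite /= mem_finsupp eq_sym.
Qed.

Lemma translate1 a : translate 1 a = a.
Proof. by apply/dsumP => x; rewrite translateE invg1 mul1g. Qed.
Lemma translateM f f' a : translate (f * f') a = translate f (translate f' a).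
Proof. by apply/dsumP => x; rewrite !translateE invgM mulgA. Qed.
Lemma translate_mul f a b : translate f (a * b) = translate f a * translate f b.
Proof.
by apply/dsumP => x; rewrite translateE !dsum_mulE !translateE.
Qed.

Definition wreath : Type := (dsum F G * F)%type.

HB.instance Definition _ := Choice.on wreath.

Definition wreath_one : wreath := (1, 1).
Definition wreath_mul (u v : wreath) : wreath :=
  (u.1 * translate u.2 v.1, u.2 * v.2).
Definition wreath_inv (u : wreath) : wreath :=
  (translate u.2^-1 u.1^-1, u.2^-1).

Lemma translate_one f : translate f 1 = 1.
Proof. by apply/dsumP => x; rewrite translateE !dsum_oneE. Qed.

Lemma wreath_mulA : associative wreath_mul.
Proof.
by move=> u v w; rewrite /wreath_mul /= translate_mul translateM !mulgA.
Qed.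
Lemma wreath_mul1g : left_id wreath_one wreath_mul.
Proof. by case=> a f; rewrite /wreath_mul /= translate1 !mul1g. Qed.
Lemma wreath_mulg1 : right_id wreath_one wreath_mul.
Proof. by case=> a f; rewrite /wreath_mul /= translate_one !mulg1. Qed.
Lemma wreath_mulVg : left_inverse wreath_one wreath_inv wreath_mul.
Proof.
by case=> a f; rewrite /wreath_mul /= -translate_mul !mulVg translate_one.
Qed.
Lemma wreath_mulgV : right_inverse wreath_one wreath_inv wreath_mul.
Proof.
by case=> a f; rewrite /wreath_mul /= -translateM !mulgV translate1 mulgV.
Qed.

HB.instance Definition _ :=
  isGroup.Build wreath
    wreath_mulA wreath_mul1g wreath_mulg1 wreath_mulVg wreath_mulgV.

End Wreath.

(* Main.v *)
Require Import Defs.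
From mathcomp Require Import all_boot finmap.
From mathcomp Require Import boolp zify.

Set Implicit Arguments.
Unset Strict Implicit.
Unset Printing Implicit Defensive.

Local Open Scope group_scope.

(** Why the theorem holds.  Let [T = t ^+ 2] and generate [G wr F] by [T], by
    the elements of [Y] and by the copy of [X] at the identity of [F].  View an
    element [(b, f)] as a lamp configuration [b] together with the position [f]
    of a lamplighter.  Fix [a] in [X] with [a <> 1], and let [w] have the value
    [a] at the two sites [T ^+ k] and [T ^- k], the lamplighter standing at the
    identity.

    A word for [w * T ^ l] describes a walk that visits both sites, with two
    additional letters to light them.  Measured in [Y]-length, where [T ^+ k]
    lies at distance [2k] from the identity, the shortest such walk ending at
    [f] has length at least [2k + 4k + (2k - |f|)]: after the second site it
    still has to come back to [f].  Every letter advances by at most [2], so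

                   [8k + 4 <= 2 |(b, f)| + |f|]                     (1)

    whenever [b] is nontrivial at both sites.  Walking with [T] alone, and
    choosing the order of the two sites according to the sign of [l], gives
    [|w T^l| = 4k + 2 - |l|] for [|l| <= k]: the length falls in both
    directions.  A letter [h] other than [T] advances by at most [1], and it
    does not touch the two sites if [|l| < k], so (1) applies to [w T^l h] with
    [|f| <= 2|l| + 1]; lengths being integers, [|w T^l h| >= 4k + 2 - |l|].  This
    is the reason for generating by [t ^+ 2] rather than by [t]: another element
    of [Y] might start an equally short way home.

    Inequality (1) is proved without speaking of walks: the length of the
    shortest tour, plus [2] for each of the two sites that is lit, is given by
    an explicit function [tour] of [(b, f)]; it vanishes at the identity
    and grows by at most [2] under each letter, hence is at most twice the word
    length ([word_length_potential]). *)

(** * Word length *)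

Section WordLengthTheory.
Variables (H : groupType) (S : {fset H}).
Local Notation len := (word_length S).

Definition is_letter (x : H) : Prop := x \in S \/ x^-1 \in S.

Lemma is_letterV x : is_letter x -> is_letter x^-1.
Proof. by case=> xS; [right; rewrite invgK | left]. Qed.

Lemma is_word_cons x s : is_word S (x :: s) <-> is_letter x /\ is_word S s.
Proof.
split=> [sS | [xS sS] y].
  by split=> [|y ys]; apply: sS; rewrite inE ?eqxx // ys orbT.
by rewrite inE => /orP[/eqP-> | /sS].
Qed.

Lemma is_word_cat s1 s2 : is_word S s1 -> is_word S s2 -> is_word S (s1 ++ s2).
Proof. by move=> s1S s2S x; rewrite mem_cat => /orP[/s1S | /s2S]. Qed.

Lemma word_length_le_size s : is_word S s -> len (\prod_(x <- s) x) <= size s.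
Proof.
move=> sS; rewrite /word_length; case: pselect => // ex.
by case: ex_minnP => n _; apply; apply/asboolP; exists s.
Qed.

Lemma word_length1 : len 1 = 0%N.
Proof.
have := @word_length_le_size [::]; rewrite big_nil /= => le0.
by apply/eqP; rewrite -leqn0; apply: le0.
Qed.

Lemma word_length_letter x : is_letter x -> len x <= 1.
Proof.
move=> xS; have := @word_length_le_size [:: x]; rewrite big_seq1; apply.
by apply/is_word_cons.
Qed.

Lemma inv_word s : is_word S s ->
  exists s', [/\ is_word S s', size s' = size s
               & \prod_(x <- s') x = (\prod_(x <- s) x)^-1].
Proof.
elim: s => [|x s IHs]; first by exists [::]; rewrite big_nil invg1.
case/is_word_cons=> xS /IHs[s' [s'S size_s' prod_s']].
exists (s' ++ [:: x^-1]); split.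
- by apply: is_word_cat => //; apply/is_word_cons; split=> //; exact: is_letterV.
- by rewrite size_cat size_s' addn1.
- by rewrite big_cat /= prod_s' big_seq1 big_cons invgM.
Qed.

Hypothesis genS : generates S.

Lemma geodesic_word h : exists s,
  [/\ is_word S s, size s = len h & \prod_(x <- s) x = h].
Proof.
rewrite /word_length; case: pselect => [ex | nex].
  by case: ex_minnP => n /asboolP.
have [s sS prod_s] := genS h.
by case: nex; exists (size s); apply/asboolP; exists s.
Qed.

Lemma word_lengthM x y : len (x * y) <= len x + len y.
Proof.
have [s [sS <- sx]] := geodesic_word x; have [r [rS <- ry]] := geodesic_word y.
rewrite -size_cat -{1}sx -{1}ry -big_cat.
exact/word_length_le_size/is_word_cat.
Qed.

Lemma word_lengthM_le x y m n : len x <= m -> len y <= n -> len (x * y) <= m + n.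
Proof. by move=> xm yn; apply: leq_trans (word_lengthM x y) (leq_add xm yn). Qed.

Lemma word_lengthV x : len x^-1 = len x.
Proof.
have leV y : len y^-1 <= len y.
  have [s [sS <- <-]] := geodesic_word y.
  by have [s' [s'S <- <-]] := inv_word sS; exact: word_length_le_size.
by apply/eqP; rewrite eqn_leq leV -{1}[x]invgK leV.
Qed.

Lemma word_lengthX_letter x n : is_letter x -> len (x ^+ n) <= n.
Proof.
move=> xS; elim: n => [|n IHn]; first by rewrite expg0 word_length1.
rewrite expgS; exact: word_lengthM_le (word_length_letter xS) IHn.
Qed.

(** Lower bounds on word length come from functions that grow at a bounded
    rate along the edges of the Cayley graph. *)
Lemma word_length_potential (phi : H -> nat) c :
    phi 1 = 0%N -> (forall u x, is_letter x -> phi (u * x) <= phi u + c) ->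
  forall h, phi h <= c * len h.
Proof.
move=> phi1 phiM h; have [s [sS <- <-]] := geodesic_word h.
suff le u : phi (u * \prod_(x <- s) x) <= phi u + c * size s.
  by have := le 1; rewrite mul1g phi1.
elim: s sS u => [_|x s IHs /is_word_cons[xS sS]] u.
  by rewrite big_nil mulg1 leq_addr.
rewrite big_cons mulgA; apply: leq_trans (IHs sS _) _.
by rewrite mulnS addnA leq_add2r phiM.
Qed.

End WordLengthTheory.

Lemma exists_nontrivial_generator (G : groupType) (X : {fset G}) :
  generates X -> (exists x : G, x <> 1) -> exists2 a, a \in X & a <> 1.
Proof.
move=> genX [x x_neq1]; have [s sX prod_s] := genX x.
apply: contrapT => noX; apply: x_neq1; rewrite -prod_s big1_seq // => y /= ys.
apply: contrapT => y_neq1; apply: noX; case: (sX y ys) => yX; first by exists y.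
by exists y^-1 => // yV; apply: y_neq1; rewrite -[y]invgK yV invg1.
Qed.

(** * Moves and lamps in a wreath product *)

Section Wreath.
Variables G F : groupType.
Local Notation W := (wreath G F).

Definition lamp (z : F) (x : G) : dsum F G := [fsfun y in [fset z]%fset => x | 1].

Definition move (f : F) : W := (1, f).
Definition site (z : F) (x : G) : W := (lamp z x, 1).

Lemma lampE z x y : lamp z x y = if y == z then x else 1.
Proof. by rewrite /lamp /dsum_fun fsfunE inE. Qed.

Lemma dsum1E (y : F) : (1 : dsum F G) y = 1.
Proof. exact: dsum_oneE. Qed.

Lemma dsumME (b c : dsum F G) y : dsum_fun (b * c) y = b y * c y.
Proof. exact: dsum_mulE. Qed.

Lemma dsumVE (b : dsum F G) y : dsum_fun b^-1 y = (b y)^-1.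
Proof. exact: dsum_invE. Qed.

Lemma wreathM (u v : W) : u * v = (u.1 * translate u.2 v.1, u.2 * v.2) :> W.
Proof. by []. Qed.

Lemma wreathV (u : W) : u^-1 = (translate u.2^-1 u.1^-1, u.2^-1) :> W.
Proof. by []. Qed.

Lemma moveM f f' : move (f * f') = move f * move f'.
Proof. by rewrite wreathM /= translate_one mulg1. Qed.

Lemma moveV f : move f^-1 = (move f)^-1.
Proof. by rewrite wreathV /= invg1 translate_one. Qed.

Lemma moveX f n : move (f ^+ n) = move f ^+ n.
Proof.
by elim: n => [|n IHn]; rewrite ?expg0 // !expgS moveM IHn.
Qed.

Lemma siteM z x y : site z (x * y) = site z x * site z y.
Proof.
rewrite wreathM /= translate1 mulg1; congr pair.
by apply/dsumP => v; rewrite dsumME !lampE; case: ifP => // _; rewrite mulg1.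
Qed.

Lemma site1 z : site z 1 = 1.
Proof. by congr pair; apply/dsumP => v; rewrite lampE dsum1E if_same. Qed.

Lemma siteV z x : site z x^-1 = (site z x)^-1.
Proof.
by apply: (mulgI (site z x)); rewrite -siteM !mulgV site1.
Qed.

Lemma conj_site z x : move z * site 1 x * move z^-1 = site z x.
Proof.
rewrite !wreathM /= translate_one !mulg1 mul1g mulgV; congr pair.
apply/dsumP => y; rewrite translateE !lampE.
by rewrite -(inj_eq (mulgI z)) mulVKg mulg1.
Qed.

Lemma mul_moveE (u : W) f : u * move f = (u.1, u.2 * f).
Proof. by rewrite wreathM /= translate_one mulg1. Qed.

Lemma mul_site2 (u : W) x : (u * site 1 x).2 = u.2.
Proof. by rewrite wreathM /= mulg1. Qed.

Lemma mul_site_at (u : W) x y : y != u.2 -> (u * site 1 x).1 y = u.1 y.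
Proof.
move=> y_neq; rewrite wreathM /= dsumME translateE lampE.
by rewrite -(inj_eq (mulgI u.2)) mulVKg mulg1 (negPf y_neq) mulg1.
Qed.

Lemma mul_site_commute p q x y : p != q ->
  site p x * site q y = site q y * site p x.
Proof.
move=> p_neq_q; rewrite !wreathM /= !translate1; congr pair.
apply/dsumP => z; rewrite !dsumME !lampE.
case: (eqVneq z p) => [->|_]; first by rewrite (negPf p_neq_q) mulg1 mul1g.
by rewrite mul1g mulg1.
Qed.

(** * The generating set *)

Definition gens (T : F) (Y : {fset F}) (X : {fset G}) : {fset W} :=
  ([fset move T] `|` [fset move y | y in Y] `|` [fset site 1 x | x in X])%fset.

Lemma gensP T Y X h :
  h \in gens T Y X ->
  [\/ h = move T, (exists2 y, y \in Y & h = move y)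
    | exists2 x, x \in X & h = site 1 x].
Proof.
rewrite !inE => /orP[/orP[/eqP->|/imfsetP[y yY ->]]|/imfsetP[x xX ->]].
- exact: Or31.
- by apply: Or32; exists y.
- by apply: Or33; exists x.
Qed.

Lemma move_gens T Y X : move T \in gens T Y X.
Proof. by rewrite !inE eqxx. Qed.

Lemma site_gens T (Y : {fset F}) (X : {fset G}) x : x \in X ->
  site 1 x \in gens T Y X.
Proof. by move=> xX; rewrite !inE; apply/orP; right; apply/imfsetP; exists x. Qed.

Lemma move_letter T (Y : {fset F}) X y : is_letter Y y ->
  is_letter (gens T Y X) (move y).
Proof.
have sub z : z \in Y -> move z \in gens T Y X.
  by move=> zY; rewrite !inE; apply/orP; left; apply/orP; right; apply/imfsetP; exists z.
by case=> /sub yS; [left | right; rewrite -moveV].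
Qed.

Lemma site_letter T Y (X : {fset G}) x : is_letter X x ->
  is_letter (gens T Y X) (site 1 x).
Proof. by case=> /site_gens xS; [left | right; rewrite -siteV]. Qed.

Lemma generates_gens T Y X :
  generates Y -> generates X -> generates (gens T Y X).
Proof.
move=> genY genX; set S := gens T Y X.
pose spanned h := exists2 s, is_word S s & \prod_(x <- s) x = h.
have spannedM h h' : spanned h -> spanned h' -> spanned (h * h').
  move=> [s sS <-] [r rS <-]; exists (s ++ r); last by rewrite big_cat.
  exact: is_word_cat.
have spanned_map (K : groupType) (Z : {fset K}) (e : K -> W) : e 1 = 1 ->
    (forall x y, e (x * y) = e x * e y) ->
    (forall x, is_letter Z x -> is_letter S (e x)) -> generates Z ->
    forall x, spanned (e x).
  move=> e1 eM eS genZ x; have [s sZ <-] := genZ x.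
  elim: s sZ => [_|y s IHs /is_word_cons[yZ sZ]].
    by exists [::] => //; rewrite !big_nil.
  rewrite big_cons eM; apply: spannedM (IHs sZ).
  by exists [:: e y]; [apply/is_word_cons; split=> //; exact: eS | rewrite big_seq1].
have spanned_move : forall f, spanned (move f).
  apply: spanned_map genY => //; [exact: moveM | exact: move_letter].
have spanned_site1 : forall x, spanned (site 1 x).
  apply: spanned_map genX; [exact: site1 | exact: siteM | exact: site_letter].
have spanned_site z x : spanned (site z x).
  by rewrite -conj_site; apply: (spannedM); first apply: (spannedM).
have spanned_dsum (r : seq F) (b : dsum F G) :
    (forall y, y \notin r -> b y = 1) -> spanned (b, 1).
  elim: r b => [|z r IHr] b br.
    exists [::] => //; rewrite big_nil; congr pair.
    by apply/dsumP => y; rewrite br // dsum1E.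
  (* switching off the lamp at [z] leaves a configuration supported in [r] *)
  have -> : (b, 1) = site z (b z) * ((lamp z (b z))^-1 * b, 1) :> W.
    by rewrite wreathM /= translate1 mulVKg mulg1.
  apply: spannedM => //; apply: IHr => y yr.
  rewrite dsumME dsumVE lampE; case: eqVneq => [->|y_neq]; first by rewrite mulVg.
  by rewrite invg1 mul1g br // inE negb_or y_neq.
case=> b f; rewrite -/(spanned _).
(* the cast selects the wreath product law rather than the direct product *)
have -> : (b, f) = ((b, 1) : W) * move f :> W by rewrite mul_moveE mul1g.
apply: spannedM => //; apply: (spanned_dsum (finsupp b)) => y.
exact: fsfun_dflt.
Qed.

(** * Length of the shortest tour *)

Section Tour.
Variables (Y : {fset F}) (genY : generates Y) (p q : F).
Local Notation len := (word_length Y).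
Local Notation dist x y := (len (x^-1 * y)).

Lemma distC x y : dist x y = dist y x.
Proof. by rewrite -word_lengthV // invgM invgK. Qed.

Lemma dist_triangle x y z : dist x z <= dist x y + dist y z.
Proof.
have -> : x^-1 * z = (x^-1 * y) * (y^-1 * z) by rewrite -mulgA mulVKg.
exact: word_lengthM.
Qed.

Lemma distxx x : dist x x = 0%N.
Proof. by rewrite mulVg word_length1. Qed.

Lemma dist1 x : dist 1 x = len x.
Proof. by rewrite invg1 mul1g. Qed.

(** Least length of a walk from the identity to [u.2] through those of the two
    sites [p] and [q] that are lit in [u.1].  Each lit site costs [2] more, so
    that lighting it may be charged at the same rate as a move. *)
Definition tour (u : W) : nat :=
  match u.1 p != 1, u.1 q != 1 with
  | false, false => len u.2
  | true, false => 2 + len p + dist p u.2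
  | false, true => 2 + len q + dist q u.2
  | true, true => 4 + dist p q + minn (len p + dist q u.2) (len q + dist p u.2)
  end.

Lemma tour1 : tour 1 = 0%N.
Proof. by rewrite /tour !dsum1E eqxx /= word_length1. Qed.

Lemma tour_move u f : tour (u * move f) <= tour u + len f.
Proof.
rewrite mul_moveE /tour /=.
have step x : dist x (u.2 * f) <= dist x u.2 + len f.
  by rewrite mulgA; exact: word_lengthM.
have := step 1; rewrite !dist1; have := step p; have := step q.
by case: (u.1 p != 1); case: (u.1 q != 1) => /=; lia.
Qed.

(** Off the sites [p] and [q] nothing changes.  At [p] the tours with and
    without [p] have the same length up to the charge [2], because the walk is
    standing at [p] already; the case where [p] is switched off uses the
    triangle inequality. *)
Lemma tour_site u x : p != q -> tour (u * site 1 x) <= tour u + 2.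
Proof.
move=> p_neq_q.
have := dist_triangle 1 p q; have := dist_triangle 1 q p; rewrite !dist1.
have := distC q p; rewrite /tour mul_site2.
have off y : y != u.2 -> (u * site 1 x).1 y = u.1 y by exact: mul_site_at.
have [u2p | p_neq] := eqVneq u.2 p.
  have -> : (u * site 1 x).1 q = u.1 q by rewrite off // u2p eq_sym.
  rewrite u2p distxx.
  by case: (u.1 p != 1); case: (u.1 q != 1); case: ((u * site 1 x).1 p != 1) => /=; lia.
have -> : (u * site 1 x).1 p = u.1 p by rewrite off // eq_sym.
have [u2q | q_neq] := eqVneq u.2 q; last first.
  have -> : (u * site 1 x).1 q = u.1 q by rewrite off // eq_sym.
  by rewrite leq_addr.
rewrite u2q distxx.
by case: (u.1 p != 1); case: (u.1 q != 1); case: ((u * site 1 x).1 q != 1) => /=; lia.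
Qed.

End Tour.

(** * Two lamps at opposite ends of a geodesic *)

Section SeesawWord.
Variables (Y : {fset F}) (genY : generates Y) (X : {fset G}) (genX : generates X).
Variables (t : F) (lent : forall n, word_length Y (t ^+ n) = n).
Variables (a : G) (aX : a \in X) (a_neq1 : a <> 1).
Variables (k : nat) (k_gt0 : 0 < k).

Local Notation T := (t ^+ 2).
Local Notation S := (gens T Y X).
Local Notation lenY := (word_length Y).
Local Notation len := (word_length S).
Local Notation p := (T ^+ k).
Local Notation q := (T ^- k).

Let genS : generates S := generates_gens T genY genX.

Definition seesaw : W := site p a * site q a.

Lemma lenYT n : lenY (T ^+ n) = (2 * n)%N.
Proof. by rewrite -expgnA lent. Qed.

Lemma lenYTV n : lenY (T ^- n) = (2 * n)%N.
Proof. by rewrite word_lengthV // lenYT. Qed.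

Lemma lenY_pq : lenY (p^-1 * q) = (4 * k)%N.
Proof. by rewrite -invgM -expgnDr lenYTV; lia. Qed.

Lemma ends_neq : p != q.
Proof.
rewrite -mulg_eq1 -expgnDr; apply/eqP => pp.
by have := lenYT (k + k); rewrite pp word_length1; lia.
Qed.

Lemma seesaw_at_ends : seesaw.1 p != 1 /\ seesaw.1 q != 1.
Proof.
rewrite /seesaw wreathM /= translate1 !dsumME !lampE !eqxx (negPf ends_neq).
by rewrite [q == p]eq_sym (negPf ends_neq) mulg1 mul1g; split; apply/eqP.
Qed.

Lemma len_lower_bound (u : W) : u.1 p != 1 -> u.1 q != 1 ->
  8 * k + 4 <= 2 * len u + lenY u.2.
Proof.
move=> up uq.
have tour_letter v h : is_letter S h -> tour Y p q (v * h) <= tour Y p q v + 2.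
  have move_le f : lenY f <= 2 ->
      tour Y p q (v * move f) <= tour Y p q v + 2.
    by move=> f_le; apply: leq_trans (tour_move genY p q v f) _; rewrite leq_add2l.
  have T_le : lenY T <= 2 by rewrite lent.
  have Y_le y : y \in Y -> lenY y <= 2.
    by move=> yY; apply: leq_trans (word_length_letter _) _ => //; left.
  case=> /gensP[hE|[y yY hE]|[x _ hE]].
  - by rewrite hE move_le.
  - by rewrite hE move_le ?Y_le.
  - by rewrite hE tour_site ?ends_neq.
  - by rewrite -[h]invgK hE -moveV move_le ?word_lengthV.
  - by rewrite -[h]invgK hE -moveV move_le ?word_lengthV ?Y_le.
  - by rewrite -[h]invgK hE -siteV tour_site ?ends_neq.
have := word_length_potential genS (tour1 Y p q) tour_letter u.
rewrite /tour up uq lenYT lenYTV lenY_pq.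
have := dist_triangle genY p u.2 1; have := dist_triangle genY q u.2 1.
rewrite !mulg1 !word_lengthV // lenYT; lia.
Qed.

(** With [U] standing for [T] or its inverse: walk to the end [U ^+ k], then to
    the opposite end, and stop short of the way home by [j] steps. *)
Lemma len_upper_bound (U : F) j : is_letter S (move U) -> j <= k ->
  len (site (U ^+ k) a * site (U ^- k) a * move (U ^- j)) <= 4 * k + 2 - j.
Proof.
move=> US j_le.
have -> : site (U ^+ k) a * site (U ^- k) a * move (U ^- j) =
    move U ^+ k * site 1 a * (move U)^-1 ^+ (k + k) * site 1 a
      * move U ^+ (k - j).
  have -> : (move U)^-1 ^+ (k + k) = move (U ^- k) * move (U ^- k).
    by rewrite expgnDr -!moveV -!moveX expVgn.
  have -> : move U ^+ (k - j) = move (U ^+ k) * move (U ^- j).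
    by rewrite -moveX -moveM -{2}(subnK j_le) expgnDr mulgK.
  by rewrite -(conj_site (U ^+ k)) -(conj_site (U ^- k)) invgK -!moveX !mulgA.
have aS : len (site 1 a) <= 1 by apply: word_length_letter; left; exact: site_gens.
have -> : (4 * k + 2 - j = k + 1 + (k + k) + 1 + (k - j))%N by lia.
do 4?[apply: (word_lengthM_le genS)] => //; apply: (word_lengthX_letter genS) => //.
exact: is_letterV.
Qed.

Lemma move_T_letter : is_letter S (move T).
Proof. by left; exact: move_gens. Qed.

Lemma seesaw_move f : (seesaw * move f).1 = seesaw.1 /\ (seesaw * move f).2 = f.
Proof. by rewrite mul_moveE /seesaw wreathM /= !mul1g. Qed.

Lemma len_seesaw_lower f : 8 * k + 4 <= 2 * len (seesaw * move f) + lenY f.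
Proof.
have [E1 E2] := seesaw_move f; have [up uq] := seesaw_at_ends.
by have := @len_lower_bound (seesaw * move f); rewrite E1 E2; apply.
Qed.

Lemma len_seesawV l : l <= k -> len (seesaw * move (T ^- l)) = (4 * k + 2 - l)%N.
Proof.
move=> l_le; apply/eqP; rewrite eqn_leq (len_upper_bound move_T_letter l_le) /=.
by have := len_seesaw_lower (T ^- l); rewrite lenYTV; lia.
Qed.

Lemma len_seesaw l : l <= k -> len (seesaw * move (T ^+ l)) = (4 * k + 2 - l)%N.
Proof.
move=> l_le; have TVS : is_letter S (move T^-1).
  by rewrite moveV; exact: is_letterV move_T_letter.
have := len_upper_bound TVS l_le; rewrite !expVgn !invgK => upper.
apply/eqP; rewrite eqn_leq {1}/seesaw (mul_site_commute _ _ ends_neq) upper /=.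
by have := len_seesaw_lower (T ^+ l); rewrite lenYT; lia.
Qed.

(** The [Y]-length of a position next to [f] is at most [2l + 1], so the bound
    on twice the length loses at most [1], which rounding absorbs. *)
Lemma len_seesaw_other f l h :
    lenY f = (2 * l)%N -> l < k -> h \in S -> h <> move T ->
  4 * k + 2 - l <= len (seesaw * move f * h) /\
  4 * k + 2 - l <= len (seesaw * move f * h^-1).
Proof.
move=> fl l_lt hS h_neq; have [E1 E2] := seesaw_move f.
have [up uq] := seesaw_at_ends.
have near_move y : lenY y <= 1 -> 4 * k + 2 - l <= len (seesaw * move f * move y).
  move=> y_le; have fy_le := word_lengthM_le genY (eq_leq fl) y_le.
  have -> : seesaw * move f * move y = seesaw * move (f * y) by rewrite moveM mulgA.
  have := leq_trans (len_seesaw_lower (f * y)) (leq_add (leqnn _) fy_le); lia.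
have near_site x : 4 * k + 2 - l <= len (seesaw * move f * site 1 x).
  have := @len_lower_bound (seesaw * move f * site 1 x).
  rewrite mul_site2 !mul_site_at ?E1 ?E2 ?fl.
  - by move=> /(_ up uq); lia.
  - by apply/eqP => qf; have := lenYTV k; rewrite qf fl; lia.
  - by apply/eqP => pf; have := lenYT k; rewrite pf fl; lia.
case: (gensP hS) => [//|[y yY ->]|[x _ ->]].
  by rewrite -moveV; split; apply: near_move; rewrite ?word_lengthV //;
     apply: word_length_letter; left.
by rewrite -siteV.
Qed.

Lemma seesaw_word_seesaw : seesaw_word S k (move T) seesaw.
Proof.
have len_pos l : l <= k -> len (seesaw * move T ^+ l) = (4 * k + 2 - l)%N.
  by rewrite -moveX; exact: len_seesaw.
have len_neg l : l <= k -> len (seesaw * move T ^- l) = (4 * k + 2 - l)%N.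
  by rewrite -moveX -moveV; exact: len_seesawV.
have other_pos l h : l < k -> h \in S -> h <> move T ->
    len (seesaw * move T ^+ l) <= len (seesaw * move T ^+ l * h) /\
    len (seesaw * move T ^+ l) <= len (seesaw * move T ^+ l * h^-1).
  move=> l_lt; rewrite len_pos ?(ltnW l_lt) // -moveX.
  exact: len_seesaw_other (lenYT l) l_lt.
have other_neg l h : l < k -> h \in S -> h <> move T ->
    len (seesaw * move T ^- l) <= len (seesaw * move T ^- l * h) /\
    len (seesaw * move T ^- l) <= len (seesaw * move T ^- l * h^-1).
  move=> l_lt; rewrite len_neg ?(ltnW l_lt) // -moveX -moveV.
  exact: len_seesaw_other (lenYTV l) l_lt.
have len0 : len seesaw = (4 * k + 2)%N.
  by have := len_pos 0%N; rewrite expg0 mulg1 subn0; apply.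
have other0 h : h \in S -> h <> move T ->
    len seesaw <= len (seesaw * h) /\ len seesaw <= len (seesaw * h^-1).
  by have := @other_pos 0%N h k_gt0; rewrite expg0 mulg1.
split; [exact: move_gens | split | move=> l l_range; split].
- by have := len_pos 1%N k_gt0; rewrite expg1 => ->; rewrite len0; lia.
- by have := len_neg 1%N k_gt0; rewrite expg1 => ->; rewrite len0; lia.
- move=> h hS len_h _; apply: contrapT => h_neq.
  by have [+ _] := other0 h hS h_neq; rewrite -len_h ltnn.
- exact: other0.
- rewrite !len_pos; lia.
- by move=> h; apply: other_pos; lia.
- rewrite !len_neg; lia.
- by move=> h; apply: other_neg; lia.
Qed.

End SeesawWord.
End Wreath.

Unset Implicit Arguments.

Theorem theorem6p3 (F G : groupType)
    (Y : {fset F}) (genY : generates Y)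
    (t : F) (isot : isometric_Z Y t)
    (X : {fset G}) (genX : generates X)
    (ntG : exists x : G, x <> 1) :
  exists S : {fset wreath G F},
    generates S /\
    forall k : nat, (0 < k)%N ->
      exists w g : wreath G F, seesaw_word S k g w.
Proof.
have [a aX a_neq1] := exists_nontrivial_generator genX ntG.
have lent n : word_length Y (t ^+ n) = n by exact: (isot (ssrint.Posz n)).
exists (gens (t ^+ 2) Y X); split; first exact: generates_gens.
move=> k k_gt0; exists (seesaw t a k), (move G (t ^+ 2)).
exact: seesaw_word_seesaw.
Qed.
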